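(* Let $G$ be a torsion-free hyperbolic group with property LR. If $G$ is hereditarily conjugacy separable, then $G$ is hereditarily SICS and hereditarily SCS.
   Context: Hyperbolic means word-hyperbolic in the sense of Gromov. For subgroups $A,B$ of a group $C$, $A$ is conjugate into $B$ (in $C$) if $c^{-1}Ac\leqslant B$ for some $c\in C$. A group $G$ is conjugacy separable (CS) if for any two non-conjugate elements of $G$ there is a homomorphism of $G$ onto a finite group under which their images are not conjugate. A group $G$ is SCS (subgroup conjugacy separable) if for any two finitely generated subgroups $H_1,H_2$ that are not conjugate in $G$ there is a homomorphism of $G$ onto a finite group $\overline G$ such that the images of $H_1$ and $H_2$ are not conjugate in $\overline G$. A group $G$ is SICS (subgroup into-conjugacy separable) if for any two finitely generated subgroups $H_1,H_2$ such that $H_2$ is not conjugate into $H_1$ in $G$ there is a homomorphism of $G$ onto a finite group $\overline G$ such that the image of $H_2$ is not conjugate into the image of $H_1$ in $\overline G$. For a property $\mathcal P$ of groups, $G$ is hereditarily $\mathcal P$ if all finite index subgroups of $G$ have property $\mathcal P$. A subgroup $H$ of a group $K$ is a retract of $K$ if there is an epimorphism $f:K\to H$ with $f|_H=\mathrm{id}$. A group $G$ has property LR if every finitely generated subgroup $H\leqslant G$ is a retract of some finite index subgroup of $G$. *)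

(* Defs.v *)
From HB Require Import structures.
From mathcomp Require Import all_boot all_order all_algebra all_fingroup.
From mathcomp Require Import mathcomp_extra boolp classical_sets functions.
From mathcomp Require Import cardinality.

Set Implicit Arguments.
Unset Strict Implicit.
Unset Printing Implicit Defensive.

Local Open Scope classical_set_scope.
Local Open Scope group_scope.

Definition is_subgroup (G : groupType) (A : set G) : Prop :=
  [/\ A 1, forall x y, A x -> A y -> A (x * y) & forall x, A x -> A x^-1].

Record subgroup (G : groupType) := Subgroup {
  subgroup_set :> set G;
  subgroupP : is_subgroup subgroup_set }.

(* A subgroup as a group in its own right; [val] is the inclusion into [G]. *)
Definition subgroup_type (G : groupType) (K : subgroup G) : Type :=
  {x : G | x \in subgroup_set K}.

Lemma subgroup_group_closed (G : groupType) (K : subgroup G) :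
  group_closed (fun x : G => x \in subgroup_set K).
Proof.
have [K1 KM KV] := subgroupP K.
by split=> [|x y /set_mem Kx /set_mem Ky]; apply/mem_set => //; apply/KM/KV.
Qed.

HB.instance Definition _ (G : groupType) (K : subgroup G) :=
  SubChoice.on (subgroup_type K).
HB.instance Definition _ (G : groupType) (K : subgroup G) :=
  SubChoice_isSubGroup.Build G _ (subgroup_type K) (subgroup_group_closed K).

Definition subgroup_generated (G : groupType) (A : set G) : set G :=
  smallest (@is_subgroup G) A.

Definition finitely_generated (G : groupType) (A : set G) : Prop :=
  exists s : seq G, A = subgroup_generated [set` s].

Definition left_coset (G : groupType) (A : set G) (g : G) : set G :=
  [set g * x | x in A].

Definition finite_index (G : groupType) (A : set G) : Prop :=
  finite_set [set left_coset A g | g in [set: G]].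

Definition hereditarily (P : groupType -> Prop) (G : groupType) : Prop :=
  forall K : subgroup G, finite_index K -> P (subgroup_type K).

Definition conjugate_elements (G : groupType) (x y : G) : Prop :=
  exists c : G, y = x ^ c.

(* [c^-1 A c], since [x ^ c = c^-1 * (x * c)]. *)
Definition conjugate_set (G : groupType) (A : set G) (c : G) : set G :=
  [set x ^ c | x in A].

Definition conjugate_subgroups (G : groupType) (A B : set G) : Prop :=
  exists c : G, conjugate_set A c = B.

Definition conjugate_into (G : groupType) (A B : set G) : Prop :=
  exists c : G, conjugate_set A c `<=` B.

(* Between groups a [{multiplicative G -> Q}] also preserves 1 and inverses. *)
Definition conjugacy_separable (G : groupType) : Prop :=
  forall x y : G, ~ conjugate_elements x y ->
  exists (Q : finGroupType) (f : {multiplicative G -> Q}),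
    set_surj [set: G] [set: Q] f /\ ~ conjugate_elements (f x) (f y).

Definition SCS (G : groupType) : Prop :=
  forall H1 H2 : subgroup G,
  finitely_generated H1 -> finitely_generated H2 ->
  ~ conjugate_subgroups H1 H2 ->
  exists (Q : finGroupType) (f : {multiplicative G -> Q}),
    set_surj [set: G] [set: Q] f /\ ~ conjugate_subgroups (f @` H1) (f @` H2).

Definition SICS (G : groupType) : Prop :=
  forall H1 H2 : subgroup G,
  finitely_generated H1 -> finitely_generated H2 ->
  ~ conjugate_into H2 H1 ->
  exists (Q : finGroupType) (f : {multiplicative G -> Q}),
    set_surj [set: G] [set: Q] f /\ ~ conjugate_into (f @` H2) (f @` H1).

(* [H] is a retract of [K], both being given as subgroups of [G]. *)
Definition retract (G : groupType) (H K : subgroup G) : Prop :=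
  H `<=` K /\
  exists f : {multiplicative subgroup_type K -> subgroup_type H},
    set_surj [set: subgroup_type K] [set: subgroup_type H] f /\
    (forall (k : subgroup_type K) (h : subgroup_type H),
      val k = val h -> f k = h).

Definition property_LR (G : groupType) : Prop :=
  forall H : subgroup G, finitely_generated H ->
  exists K : subgroup G, finite_index K /\ retract H K.

Definition torsion_free (G : groupType) : Prop :=
  forall (x : G) (n : nat), (0 < n)%N -> x ^+ n = 1 -> x = 1.

(* [g] is a product of [n] factors from [s] and the inverses of [s]. *)
Definition spelled (G : groupType) (s : seq G) (g : G) (n : nat) : Prop :=
  exists w : seq G,
    [/\ size w = n, all (fun a => (a \in s) || (a^-1 \in s)) w
      & g = \prod_(a <- w) a].

(* The junk value 0 is taken outside the subgroup generated by [s]; it is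
   never used in [hyperbolic], where [s] generates the group. *)
Definition word_length (G : groupType) (s : seq G) (g : G) : nat :=
  if pselect (exists n, `[< spelled s g n >]) is left e then ex_minn e else 0%N.

Definition word_dist (G : groupType) (s : seq G) (x y : G) : nat :=
  word_length s (x^-1 * y).

Definition gromov_product (T : Type) (d : T -> T -> nat) (w x y : T) : rat :=
  (((d x w)%:R + (d y w)%:R - (d x y)%:R) / 2%:R)%R.

(* A rational [delta] loses no generality: [delta] may always be enlarged. *)
Definition gromov_hyperbolic (T : Type) (d : T -> T -> nat) : Prop :=
  exists2 delta : rat, (0 <= delta)%R &
  forall w x y z : T,
    (Num.min (gromov_product d w x z) (gromov_product d w z y) - delta
       <= gromov_product d w x y)%R.

Definition hyperbolic (G : groupType) : Prop :=
  exists s : seq G,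
    subgroup_generated [set` s] = [set: G] /\ gromov_hyperbolic (word_dist s).

(* Main.v *)
(* For a retraction f of a finite index subgroup L onto H1: if H2 is conjugate into
   H1 in every finite quotient, then, after conjugating H2 into L, f restricted to H2
   is a conjugation in every finite quotient of G.  It remains to see that a map phi
   which is a conjugation in every finite quotient is a conjugation by an element of
   G.  By conjugacy separability phi may be assumed to fix some h <> 1 of H2, and
   Minasyan's centralizer condition puts the conjugators into the centralizer of h,
   which is virtually <h> as G contains no Z x Z.  Take a retraction rho of a finite
   index subgroup onto <h>.  If rho is injective on H2, then powers of h centralize
   H2 and finitely many conjugators suffice.  Otherwise some t <> 1 in H2 has
   rho t = 1; phi t is t ^ g, so the conjugators h^j are modulo every finite index
   subgroup congruent to elements of C(t) g, on which rho determines h^j.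

   Hyperbolicity only serves to exclude Z x Z = <d, t>.  By LR such a subgroup is
   undistorted, so d^n and d^-n (n = 2^k) are joined by a path of 4n steps at distance
   at least n / C from 1; hence their Gromov product is at least n / C - O(k).  It
   equals |d^n| - |d^2n| / 2, so |d^(2^k)| / 2^k would decrease by a constant at each
   step.

   SCS follows, since H ^ g <= H implies H ^ g = H for the finitely generated, hence
   separable, subgroup H. *)

Require Import Defs.
From HB Require Import structures.
From mathcomp Require Import all_boot all_order all_algebra all_fingroup.
From mathcomp Require Import mathcomp_extra boolp classical_sets functions.
From mathcomp Require Import cardinality finmap ring lra zify.
From mathcomp Require Import monoid.

Set Implicit Arguments.
Unset Strict Implicit.
Unset Printing Implicit Defensive.

Local Open Scope classical_set_scope.
Local Open Scope group_scope.

(** * Finite index subgroups *)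


Ltac gnorm :=
  rewrite ?conjgE ?(invgM, invgK, mulgA, mulgV, mulVg, mulg1, mul1g, mulgK,
    mulgVK, invg1).

Section Labelling.
Implicit Type G : groupType.

(* For a subgroup [A]: finite index, [p] being finer than the partition into left
   cosets of [A]. *)
Definition labelled G (A : set G) :=
  exists (T : finType) (p : G -> T), forall x y, p x = p y -> A (x^-1 * y).

Definition hom_on G G' (L : set G) (f : G -> G') :=
  forall x y, L x -> L y -> f (x * y) = f x * f y.

Record cofinite_normal G (A : set G) : Prop := CofiniteNormal {
  cofinite_subgroup : is_subgroup A;
  cofinite_conj : forall x g, A x -> A (x ^ g);
  cofinite_labelled : labelled A }.

Record virtual_retraction G (H L : set G) (f : G -> G) : Prop :=
  VirtualRetraction {
  vr_subgroup : is_subgroup L;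
  vr_labelled : labelled L;
  vr_sub : H `<=` L;
  vr_hom : hom_on L f;
  vr_in : forall x, L x -> H (f x);
  vr_id : forall x, H x -> f x = x }.

Lemma labelled_sub G (A B : set G) : A `<=` B -> labelled A -> labelled B.
Proof. by move=> AB [T [p pP]]; exists T, p => x y /pP /AB. Qed.

Lemma labelled_setT G : labelled [set: G].
Proof. by exists unit, (fun=> tt). Qed.

Lemma labelled_setI G (A B : set G) :
  labelled A -> labelled B -> labelled (A `&` B).
Proof.
move=> [T [p pP]] [T' [q qP]]; exists (T * T')%type, (fun x => (p x, q x)).
by move=> x y [/pP Axy /qP].
Qed.

Lemma label_representative G (T : finType) (p : G -> T) :
  exists r : T -> G, forall x, p (r (p x)) = p x.
Proof.
have /boolp.choice [r rP] : forall t, exists y, forall x, p x = t -> p y = t.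
  move=> t; have [[y yt]|nex] := pselect (exists y, p y = t); first by exists y.
  by exists 1 => x xt; case: nex; exists x.
by exists r => x; apply: rP.
Qed.

Lemma is_subgroup_setT G : is_subgroup [set: G].
Proof. by []. Qed.

Lemma is_subgroup_setI G (A B : set G) :
  is_subgroup A -> is_subgroup B -> is_subgroup (A `&` B).
Proof.
move=> [A1 AM AV] [B1 BM BV]; split=> // [x y [? ?] [? ?]|x [? ?]].
  by split; [apply: AM|apply: BM].
by split; [apply: AV|apply: BV].
Qed.

Section IsSubgroup.
Variables (G : groupType) (A : set G).
Hypothesis sA : is_subgroup A.

Lemma subgroup1 : A 1. Proof. by case: sA. Qed.

Lemma subgroupM x y : A x -> A y -> A (x * y). Proof. by case: sA => _ + _; exact. Qed.

Lemma subgroupV x : A x -> A x^-1. Proof. by case: sA => _ _; exact. Qed.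

Lemma subgroupJ x y : A x -> A y -> A (x ^ y).
Proof. by move=> Ax Ay; apply: subgroupM; [apply: subgroupV|apply: subgroupM]. Qed.

Lemma subgroupX x n : A x -> A (x ^+ n).
Proof.
by move=> Ax; elim: n => [|n IHn]; [exact: subgroup1|rewrite expgS; apply: subgroupM].
Qed.

End IsSubgroup.

Section HomOn.
Variables (G G' : groupType) (L : set G) (f : G -> G').
Hypotheses (sL : is_subgroup L) (fM : hom_on L f).

Lemma hom_on1 : f 1 = 1.
Proof.
have [L1 _ _] := sL; apply: (mulgI (f 1)).
by rewrite -fM // !mulg1.
Qed.

Lemma hom_onV x : L x -> f x^-1 = (f x)^-1.
Proof.
have [L1 _ LV] := sL => Lx; apply: (mulgI (f x)).
by rewrite -fM ?mulgV ?hom_on1//; apply: LV.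
Qed.

Lemma hom_onJ x y : L x -> L y -> f (x ^ y) = f x ^ f y.
Proof.
have [_ LM LV] := sL => Lx Ly.
by rewrite !conjgE !fM ?hom_onV//; [apply: LV|apply: LM].
Qed.

Lemma is_subgroup_preimage (A : set G') :
  is_subgroup A -> is_subgroup [set x | L x /\ A (f x)].
Proof.
have [L1 LM LV] := sL; move=> [A1 AM AV]; split=> /=.
- by split=> //; rewrite hom_on1.
- by move=> x y [? ?] [? ?]; split; [apply: LM|rewrite fM//; apply: AM].
- by move=> x [? ?]; split; [apply: LV|rewrite hom_onV//; apply: AV].
Qed.

Lemma is_subgroup_image (H : set G) :
  H `<=` L -> is_subgroup H -> is_subgroup (f @` H).
Proof.
move=> HL [H1 HM HV]; split.
- by exists 1 => //; rewrite hom_on1.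
- move=> _ _ [x Hx <-] [y Hy <-]; exists (x * y); first exact: HM.
  by rewrite fM//; apply: HL.
- move=> _ [x Hx <-]; exists x^-1; first exact: HV.
  by rewrite hom_onV//; apply: HL.
Qed.

(** An element is labelled by its class under [p] together with the label of [f] at its offset from
    the representative of that class; such offsets lie in [L], where [f] is multiplicative. *)
Lemma labelled_preimage (A : set G') :
  labelled L -> labelled A -> labelled [set x | L x /\ A (f x)].
Proof.
have [L1 LM LV] := sL.
move=> [T [p pP]] [T' [q qP]]; have [r rP] := label_representative p.
exists (T * T')%type, (fun x => (p x, q (f ((r (p x))^-1 * x)))).
move=> x y [pxy]; rewrite -pxy => /qP.
have Lx : L ((r (p x))^-1 * x) by apply: pP; rewrite rP.
have Ly : L ((r (p x))^-1 * y) by apply: pP; rewrite rP.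
have -> : x^-1 * y = ((r (p x))^-1 * x)^-1 * ((r (p x))^-1 * y) by gnorm.
by rewrite -hom_onV// -fM//; [split=> //; apply: LM => //|]; apply: LV.
Qed.

End HomOn.

(* The core: x acts on the labels of the left cosets through p (x * r t). *)
Lemma labelled_core G (A : set G) : is_subgroup A -> labelled A ->
  exists2 B, cofinite_normal B & B `<=` A.
Proof.
move=> [A1 AM AV] [T [p pP]]; have [r rP] := label_representative p.
exists [set x | forall g, A (x ^ g)]; last first.
  by move=> x /(_ 1); rewrite conjg1.
split.
- split=> /= [g|x y Ax Ay g|x Ax g]; first by rewrite conj1g.
    by rewrite conjMg; apply: AM.
  by rewrite conjVg; apply: AV.
- by move=> x g /= Ax h; rewrite -conjgM.
- exists {ffun T -> T}, (fun x => [ffun t => p (x * r t)]) => x y /ffunP exy g.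
  have := exy (p g); rewrite !ffunE => /pP.
  have Ag : A ((r (p g))^-1 * g) by apply: pP; rewrite rP.
  move=> Axy; have := AM _ _ (AV _ Ag) (AM _ _ Axy Ag); gnorm.
  by [].
Qed.

Lemma cofinite_normalT G : cofinite_normal [set: G].
Proof. by split; [apply: is_subgroup_setT|by []|apply: labelled_setT]. Qed.

Lemma cofinite_normalI G (A B : set G) :
  cofinite_normal A -> cofinite_normal B -> cofinite_normal (A `&` B).
Proof.
move=> [sA nA lA] [sB nB lB]; split; first exact: is_subgroup_setI.
  by move=> x g [Ax Bx]; split; [apply: nA|apply: nB].
exact: labelled_setI.
Qed.

(** Compactness: if each [t] failed at some cofinite normal subgroup, all of them would fail at the
    intersection of these finitely many subgroups. *)
Lemma cofinite_normal_pigeonhole G (T : finType) (P : T -> set G -> Prop) :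
    (forall t A B, B `<=` A -> P t B -> P t A) ->
    (forall A, cofinite_normal A -> exists t, P t A) ->
  exists t, forall A, cofinite_normal A -> P t A.
Proof.
move=> Pmono exP; apply: contrapT => nex.
have [B nB BP] : exists2 B, cofinite_normal B & forall t, t \in enum T -> ~ P t B.
  elim: (enum T) => [|t s [B nB BP]].
    by exists setT => //; apply: cofinite_normalT.
  have [A [nA nPA]] : exists A, cofinite_normal A /\ ~ P t A.
    apply: contrapT => nA; apply: nex; exists t => A cA.
    by apply: contrapT => nP; apply: nA; exists A.
  exists (A `&` B); first exact: cofinite_normalI.
  move=> u; rewrite inE => /orP[/eqP ->|us] PAB.
    by apply: nPA; apply: Pmono PAB; apply: subIsetl.
  by apply: (BP _ us); apply: Pmono PAB; apply: subIsetr.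
by have [t] := exP _ nB; apply: BP; rewrite mem_enum.
Qed.

(** Pigeonhole over the labels of [L]: the witnesses for all [A] can be taken in one coset [c * L].
    The clause [P c setT] retains for [c] the parts of [P] that do not depend on [A]. *)
Lemma labelled_pigeonhole G (L : set G) (P : G -> set G -> Prop) :
    labelled L ->
    (forall x A B, B `<=` A -> P x B -> P x A) ->
    (forall A, cofinite_normal A -> exists x, P x A) ->
  exists2 c, P c setT & forall A, cofinite_normal A ->
    exists2 x, L (c^-1 * x) & P x A.
Proof.
move=> [T [p pP]] Pmono exP.
have [||t tP] := @cofinite_normal_pigeonhole G T
    (fun t A => exists2 x, p x = t & P x A).
- by move=> t A B BA [x xt Px]; exists x => //; apply: Pmono Px.
- by move=> A /exP [x Px]; exists (p x), x.
have [c ct Pc] := tP _ (cofinite_normalT G).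
exists c => // A /tP [x xt Px]; exists x => //.
by apply: pP; rewrite ct xt.
Qed.

Lemma finite_index_labelled G (A : set G) :
  is_subgroup A -> finite_index A -> labelled A.
Proof.
move=> [A1 AM AV] fA; rewrite /finite_index in fA.
set S := (X in finite_set X) in fA.
have lS g : left_coset A g \in fset_set S.
  by rewrite in_fset_set//; apply/mem_set; exists g.
exists (fset_set S), (fun g => [` lS g]%fset) => x y /(congr1 val)/= exy.
have : left_coset A y y by exists 1 => //; rewrite mulg1.
by rewrite -exy => -[a Aa <-]; rewrite mulKg.
Qed.

Lemma labelled_finite_index G (A : set G) :
  is_subgroup A -> labelled A -> finite_index A.
Proof.
move=> [A1 AM AV] [T [p pP]]; have [r rP] := label_representative p.
apply: (@sub_finite_set _ _ [set left_coset A (r t) | t in [set: T]]).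
  move=> _ [g _ <-]; exists (p g) => //.
  have Ag : A ((r (p g))^-1 * g) by apply: pP; rewrite rP.
  apply/seteqP; split=> _ [a Aa <-].
    exists (((r (p g))^-1 * g)^-1 * a); first by apply: AM => //; apply: AV.
    by gnorm.
  by exists (((r (p g))^-1 * g) * a); [apply: AM|gnorm].
exact: finite_image.
Qed.

End Labelling.

(** * Finite quotients *)


(** Separability is defined by surjections onto finite groups, so the target is cut down to the
    range of [f]. *)
Lemma multiplicative_range (G : groupType) (Q : finGroupType) (f : G -> Q) :
    {morph f : x y / x * y} ->
  exists (Q' : finGroupType) (f' : {multiplicative G -> Q'}),
    set_surj [set: G] [set: Q'] f' /\ forall x, f' x = 1 -> f x = 1.
Proof.
move=> fM; pose R := [set s | `[< exists g, s = f g >] ]%SET.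
have f1 : f 1 = 1 by apply: (mulgI (f 1)); rewrite -fM !mulg1.
have Rf g : f g \in R by rewrite inE; apply/asboolP; exists g.
have gR : group_set R.
  apply/group_setP; split=> [|s t]; first by rewrite -f1.
  by rewrite !inE => /asboolP[g ->] /asboolP[h ->]; apply/asboolP; exists (g * h).
pose RG := group gR.
pose F (g : G) : subg_of RG := subg RG (f g).
have FM : {morph F : x y / x * y}.
  by move=> x y; rewrite /F fM morphM ?Rf.
pose F' : {multiplicative G -> subg_of RG} :=
  HB.pack F (isMultiplicative.Build G (subg_of RG) F FM).
exists (subg_of RG), F'; split.
  move=> s _ /=; have := valP s; rewrite inE => /asboolP[g sg].
  by exists g => //; apply: val_inj; rewrite /= /F sg subgK.
move=> x /(congr1 (@sgval _ RG)); rewrite /= /F subgK ?Rf//.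
Qed.

(** [G] permutes the left cosets of [A] by left translation, and an element that fixes the coset [A]
    lies in [A]. *)
Lemma finite_quotient (G : groupType) (A : set G) :
    is_subgroup A -> labelled A ->
  exists (Q : finGroupType) (f : {multiplicative G -> Q}),
    set_surj [set: G] [set: Q] f /\ forall x, f x = 1 -> A x.
Proof.
move=> sA lA; have fA := labelled_finite_index sA lA; rewrite /finite_index in fA.
set S := (X in finite_set X) in fA.
have mulS (g : G) (X : fset_set S) : [set g * x | x in fsval X] \in fset_set S.
  have : fsval X \in S by rewrite -(in_fset_set fA); apply: fsvalP.
  move=> /set_mem[h _ <-]; rewrite in_fset_set//; apply/mem_set; exists (g * h) => //.
  apply/seteqP; split=> [_ [a Aa <-]|].
    by exists (h * a); [exists a|rewrite mulgA].
  by move=> _ [_ [a Aa <-] <-]; exists a => //; rewrite mulgA.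
pose act g (X : fset_set S) : fset_set S := [` mulS g X]%fset.
have actK g : cancel (act g) (act g^-1).
  move=> X; apply: val_inj => /=; apply/seteqP; split=> [_ [_ [x Xx <-] <-]|].
    by rewrite mulKg.
  by move=> x Xx; exists (g * x); [exists x|rewrite mulKg].
(* The inverse is there because a product of permutations applies its left factor first. *)
pose f g := perm (can_inj (actK g^-1)).
have fM : {morph f : x y / x * y}.
  move=> x y; apply/permP => X; rewrite permM !permE; apply: val_inj => /=.
  rewrite invgM; apply/seteqP; split=> [_ [z Xz <-]|_ [_ [z Xz <-] <-]].
    by exists (x^-1 * z); [exists z|rewrite mulgA].
  by exists z => //; rewrite mulgA.
have [Q [F [surjF F1]]] := multiplicative_range fM.
exists Q, F; split=> // x /F1 fx.
have [A1 AM AV] := sA.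
have SA : A \in fset_set S.
  rewrite in_fset_set//; apply/mem_set; exists 1 => //.
  apply/seteqP; split=> [_ [a Aa <-]|a Aa]; first by rewrite mul1g.
  by exists a => //; rewrite mul1g.
have /(congr1 val)/= := congr1 (fun s : {perm fset_set S} => s [` SA]%fset) fx.
rewrite perm1 permE/= => e; have : [set x^-1 * y | y in A] x^-1.
  by exists 1 => //; rewrite mulg1.
by rewrite e => /AV; rewrite invgK.
Qed.

(* Hereditary conjugacy separability; it is enough to consider the finite quotients
   of [M] that are induced by finite quotients of [G]. *)
Definition hcs (G : groupType) := forall M : set G,
  is_subgroup M -> labelled M -> forall x y, M x -> M y ->
  (forall B, cofinite_normal B -> exists2 m, M m & B (y^-1 * x ^ m)) ->
  exists2 m, M m & y = x ^ m.

Definition virtually_retracting (G : groupType) := forall H : set G,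
  is_subgroup H -> finitely_generated H ->
  exists (L : set G) (f : G -> G), virtual_retraction H L f.

(** * Passing to finite index subgroups *)

Section SubgroupType.
Variables (G : groupType) (M : subgroup G).
Implicit Types (x y : G) (u v : subgroup_type M).

Definition inc u : G := val u.

Lemma inc_inj : injective inc. Proof. exact: val_inj. Qed.

Definition to_sub x : subgroup_type M := insubd 1 x.

Lemma to_subK x : subgroup_set M x -> inc (to_sub x) = x.
Proof. by move=> Mx; rewrite /inc val_insubd; case: ifP => // /negP[]; apply/mem_set. Qed.

Lemma incK u : to_sub (inc u) = u.
Proof. exact: valKd. Qed.

Lemma in_sub u : subgroup_set M (inc u).
Proof. exact: set_mem (valP u). Qed.

Lemma incM u v : inc (u * v) = inc u * inc v. Proof. exact: valM. Qed.

Lemma hom_on_inc : hom_on [set: subgroup_type M] inc.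
Proof. by move=> u v _ _; apply: incM. Qed.

Lemma inc1 : inc (1 : subgroup_type M) = 1.
Proof. exact: (hom_on1 (@is_subgroup_setT _) hom_on_inc). Qed.

Lemma incV u : inc u^-1 = (inc u)^-1.
Proof. exact: (hom_onV (@is_subgroup_setT _) hom_on_inc). Qed.

Lemma incJ u v : inc (u ^ v) = inc u ^ inc v.
Proof. by rewrite !conjgE !incM incV. Qed.

Lemma hom_on_to_sub : hom_on M to_sub.
Proof.
have [_ MM _] := subgroupP M.
by move=> x y Mx My; apply: inc_inj; rewrite incM !to_subK//; apply: MM.
Qed.

Lemma cofinite_normal_inc (B : set G) : cofinite_normal B ->
  cofinite_normal [set u : subgroup_type M | B (inc u)].
Proof.
move=> [sB nB lB]; have e : [set u : subgroup_type M | B (inc u)] =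
  [set u | setT u /\ B (inc u)] by apply/seteqP; split=> u // -[].
split; rewrite ?e.
- exact: is_subgroup_preimage (@is_subgroup_setT _) hom_on_inc _ _.
- move=> u v [_ Bu]; split; first by []. by rewrite incJ; apply: nB.
- exact: labelled_preimage (@is_subgroup_setT _) hom_on_inc _ (labelled_setT _) _.
Qed.

End SubgroupType.

Lemma hcs_subgroup (G : groupType) (K : subgroup G) :
  labelled K -> hcs G -> hcs (subgroup_type K).
Proof.
move=> lK hG M sM lM u v Mu Mv uv.
have [|||||m [Km Mm] e] :=
  hG [set x | subgroup_set K x /\ M (to_sub K x)] _ _ (inc u) (inc v).
- exact: is_subgroup_preimage (subgroupP K) (@hom_on_to_sub _ K) _ _.
- exact: labelled_preimage (subgroupP K) (@hom_on_to_sub _ K) _ _ _.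
- by rewrite /= incK; split=> //; apply: in_sub.
- by rewrite /= incK; split=> //; apply: in_sub.
- move=> B /(cofinite_normal_inc K)/uv[m Mm /= Bm]; exists (inc m).
    by rewrite /= incK; split=> //; apply: in_sub.
  by rewrite -incV -incJ -incM.
- exists (to_sub K m) => //.
  by apply: inc_inj; rewrite incJ to_subK.
Qed.

(** If [x] and [y] were not conjugate in [M], a finite quotient [Q] of [M] would tell them apart.
    Its kernel has finite index in [G], so it contains some [B] normal in [G]; a conjugation modulo
    [B] by an element of [M] then survives in [Q]. *)
Lemma hcsP (G : groupType) : hereditarily conjugacy_separable G -> hcs G.
Proof.
move=> csG M sM lM x y Mx My xy; apply: contrapT => nxy.
pose MS := Subgroup sM.
have [Q [f [_ nf]]] : exists (Q : finGroupType)
    (f : {multiplicative subgroup_type MS -> Q}),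
    set_surj [set: subgroup_type MS] [set: Q] f /\
    ~ conjugate_elements (f (to_sub MS x)) (f (to_sub MS y)).
  apply: csG; first exact: labelled_finite_index.
  move=> [c e]; apply: nxy; exists (inc c); first exact: (@in_sub _ MS c).
  by have := congr1 (@inc _ MS) e; rewrite incJ !(@to_subK _ MS).
have fM : hom_on M (f \o to_sub MS).
  by move=> u v Mu Mv; rewrite /= (@hom_on_to_sub _ MS)// gmulfM.
have lQ : labelled [set (1 : Q)].
  by exists Q, id => u v ->; rewrite mulVg.
have sQ : is_subgroup [set (1 : Q)].
  by split=> // [u v -> ->|u ->]; rewrite ?mulg1 ?invg1.
have [B cB BN] := labelled_core (is_subgroup_preimage sM fM sQ)
  (labelled_preimage sM fM lM lQ).
have [m Mm /BN[_ /= e]] := xy _ cB; apply: nf; exists (f (to_sub MS m)).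
have Mxm : M (x ^ m) by apply: subgroupJ.
move: e; rewrite -/((f \o to_sub MS) _) fM//; last exact: subgroupV.
rewrite (hom_onV sM fM)// (hom_onJ sM fM)//= => /mulg1_eq.
by rewrite invgK.
Qed.

(** * Integer powers and generated subgroups *)


Section IntegerPowers.
Variable G : groupType.
Implicit Types (x y : G) (m n : int).

Definition expgz x n : G :=
  match n with Posz k => x ^+ k | Negz k => x ^- k.+1 end.

Lemma expgz1 x : expgz x 1 = x. Proof. exact: expg1. Qed.

Lemma expgzS x n : expgz x (n + 1)%R = expgz x n * x.
Proof.
case: n => [n|[|n]].
- by rewrite -PoszD addn1 /= expgSr.
- by rewrite /= mulVg.
- have -> : (Negz n.+1 + 1)%R = Negz n by rewrite !NegzE; lia.
  by rewrite /= (expgS x n.+1) invgM mulgVK.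
Qed.

Lemma expgzP x n : expgz x (n - 1)%R = expgz x n * x^-1.
Proof.
have {2}-> : n = (n - 1 + 1)%R by lia.
by rewrite expgzS mulgK.
Qed.

Lemma expgzD x m n : expgz x (m + n)%R = expgz x m * expgz x n.
Proof.
elim: n => [|n IHn|n IHn]; first by rewrite GRing.addr0 /= mulg1.
  have [-> ->] : (m + n.+1 = m + n + 1)%R /\ (n.+1 = n%:Z + 1 :> int)%R by lia.
  by rewrite !expgzS IHn mulgA.
have [-> ->] : (m - n.+1%:Z = m - n%:Z - 1)%R /\ (- n.+1%:Z = - n%:Z - 1)%R by lia.
by rewrite !expgzP IHn mulgA.
Qed.

Lemma expgzN x n : expgz x (- n)%R = (expgz x n)^-1.
Proof. by apply: (mulgI (expgz x n)); rewrite -expgzD GRing.subrr mulgV. Qed.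

Lemma expgzM x m n : expgz x (m * n)%R = expgz (expgz x m) n.
Proof.
elim: n => [|n IHn|n IHn]; first by rewrite GRing.mulr0.
  have [-> ->] : (m * n.+1 = m * n + m)%R /\ (n.+1 = n%:Z + 1 :> int)%R by lia.
  by rewrite expgzS expgzD IHn.
have [-> ->] : (m * - n.+1%:Z = m * - n%:Z - m)%R /\
  (- n.+1%:Z = - n%:Z - 1)%R by lia.
by rewrite expgzP expgzD IHn !expgzN.
Qed.

Lemma expgz_nat x (n : nat) : expgz x n = x ^+ n. Proof. by []. Qed.

Lemma sub_expgz (A : set G) x n : is_subgroup A -> A x -> A (expgz x n).
Proof.
by move=> sA Ax; case: n => n /=; [|apply: subgroupV => //]; apply: subgroupX.
Qed.

Lemma commute_expgz x y n : commute x y -> commute x (expgz y n).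
Proof. by move=> xy; case: n => n /=; [|apply: commuteV]; apply: commuteX. Qed.

Lemma expgz_eq1 x n : torsion_free G -> expgz x n = 1 -> x = 1 \/ n = 0%R.
Proof.
move=> tfG; case: n => [[|n]|n] /=; first by right.
  by move=> e; left; apply: tfG e.
by move/eqP; rewrite invg_eq1 => /eqP e; left; apply: tfG e.
Qed.

End IntegerPowers.

Section Generation.
Variable G : groupType.

Lemma sub_generated (S : set G) : S `<=` subgroup_generated S.
Proof. exact: sub_smallest. Qed.

Lemma generated_sub (S A : set G) :
  is_subgroup A -> S `<=` A -> subgroup_generated S `<=` A.
Proof. by move=> sA SA; apply: smallest_sub. Qed.

Lemma is_subgroup_generated (S : set G) : is_subgroup (subgroup_generated S).
Proof.
split=> [A [sA _]|x y Sx Sy A SA|x Sx A SA]; first exact: subgroup1.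
  by have [sA _] := SA; apply: subgroupM => //; [apply: Sx|apply: Sy].
by have [sA _] := SA; apply: subgroupV => //; apply: Sx.
Qed.

End Generation.

Section GeneratedImages.
Variable G : groupType.

Lemma generated_image (G' : groupType) (f : G -> G') (s : seq G) :
  hom_on setT f ->
  f @` subgroup_generated [set` s] = subgroup_generated [set` map f s].
Proof.
move=> fM; have sT := @is_subgroup_setT G; apply/seteqP; split.
  move=> _ [x sx <-].
  suff /(_ x sx) [//] : subgroup_generated [set` s] `<=`
      [set x | setT x /\ subgroup_generated [set` map f s] (f x)].
  apply: generated_sub.
    exact: (is_subgroup_preimage sT fM (is_subgroup_generated _)).
  move=> y /= ys; split=> //; apply: sub_generated.
  by rewrite /= map_f.
apply: generated_sub.
  by apply: (is_subgroup_image sT fM) => //; apply: is_subgroup_generated.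
by move=> _ /= /mapP[x xs ->]; exists x => //; apply: sub_generated.
Qed.

Lemma finitely_generated_image (G' : groupType) (f : G -> G') (H : set G) :
  hom_on setT f -> finitely_generated H -> finitely_generated (f @` H).
Proof. by move=> fM [s ->]; exists (map f s); apply: generated_image. Qed.

Lemma generated1 (h : G) :
  subgroup_generated [set` [:: h]] = [set expgz h n | n in [set: int]].
Proof.
apply/seteqP; split.
  apply: generated_sub.
    split; first by exists 0%R.
      by move=> _ _ [m _ <-] [n _ <-]; exists (m + n)%R; rewrite ?expgzD.
    by move=> _ [m _ <-]; exists (- m)%R; rewrite ?expgzN.
  by move=> x /=; rewrite inE => /eqP ->; exists 1%R.
move=> _ [n _ <-]; apply: (sub_expgz n (is_subgroup_generated _)).
by apply: sub_generated; rewrite /= inE.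
Qed.

Lemma generated2 (d t : G) : commute d t ->
  subgroup_generated [set` [:: d; t]] =
  [set x | exists i j : int, x = expgz d i * expgz t j].
Proof.
move=> dt; have ct i j : commute (expgz d i) (expgz t j).
  by apply/commute_expgz/commute_sym/commute_expgz/commute_sym.
apply/seteqP; split.
  apply: generated_sub.
    split; first by exists 0%R, 0%R; rewrite /= mulg1.
      move=> _ _ [i [j ->]] [i' [j' ->]]; exists (i + i')%R, (j + j')%R.
      by rewrite !expgzD !mulgA -(mulgA (expgz d i)) -(ct i' j) mulgA.
    move=> _ [i [j ->]]; exists (- i)%R, (- j)%R.
    by rewrite !expgzN invgM -!expgzN ct.
  move=> x /=; rewrite !inE => /orP[]/eqP ->.
    by exists 1%R, 0%R; rewrite /= mulg1.
  by exists 0%R, 1%R; rewrite /= mul1g.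
move=> _ [i [j ->]].
have sg := is_subgroup_generated [set` [:: d; t]].
by apply: (subgroupM sg); apply: (sub_expgz _ sg); apply: sub_generated;
  rewrite /= !inE eqxx ?orbT.
Qed.

End GeneratedImages.

Lemma property_LR_virtually_retracting (G : groupType) :
  property_LR G -> virtually_retracting G.
Proof.
move=> lrG H sH fgH; have [K [fK [HK [f [_ fid]]]]] := lrG (Subgroup sH) fgH.
pose S := Subgroup sH.
exists K, (fun x => inc (f (to_sub K x) : subgroup_type S)).
have sK := subgroupP K.
split=> //; first exact: finite_index_labelled.
- by move=> x y Kx Ky; rewrite hom_on_to_sub// gmulfM incM.
- by move=> x _; apply: (in_sub (M := S)).
- move=> x Hx; rewrite (fid _ (to_sub S x)); first by rewrite (to_subK (M := S)).
  by rewrite -!/(inc _) (to_subK (M := S))// to_subK//; apply: HK.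
Qed.

Lemma virtually_retracting_subgroup (G : groupType) (K : subgroup G) :
  virtually_retracting G -> virtually_retracting (subgroup_type K).
Proof.
move=> vrG H sH fgH.
have sT := @is_subgroup_setT (subgroup_type K).
have homi := @hom_on_inc _ K.
have [||L [f [sL lL HL fM fin fid]]] := vrG (@inc _ K @` H).
- by apply: (is_subgroup_image sT homi).
- exact: finitely_generated_image.
have fH (u : subgroup_type K) : L (inc u) -> exists2 v, H v & f (inc u) = inc v.
  by move=> /fin[v Hv e]; exists v.
exists [set u | setT u /\ L (inc u)], (fun u => to_sub K (f (inc u))); split.
- exact: is_subgroup_preimage.
- by apply: labelled_preimage => //; apply: labelled_setT.
- by move=> u Hu; split=> //; apply: HL; exists u.
- move=> u v [_ Lu] [_ Lv]; rewrite incM fM// hom_on_to_sub//.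
    by have [w _ ->] := fH _ Lu; exact: in_sub.
  by have [w _ ->] := fH _ Lv; exact: in_sub.
- by move=> u [_ /fH[v Hv ->]]; rewrite incK.
- by move=> u Hu; rewrite fid ?incK//; exists u.
Qed.

(* For torsion-free [G]: no subgroup is isomorphic to Z x Z. *)
Definition commuting_commensurable (G : groupType) := forall d t : G,
  commute d t -> t <> 1 ->
  exists (a : nat) (b : int), (0 < a)%N /\ d ^+ a = expgz t b.

(** These four properties pass to finite index subgroups, so hyperbolicity has to be exploited only
    once, for [G] itself. *)
Record tame (G : groupType) : Prop := Tame {
  tame_torsion_free : torsion_free G;
  tame_vr : virtually_retracting G;
  tame_hcs : hcs G;
  tame_cc : commuting_commensurable G }.

Lemma inc_expgz (G : groupType) (K : subgroup G) (u : subgroup_type K) n :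
  inc (expgz u n) = expgz (inc u) n.
Proof.
have incX k : inc (u ^+ k) = inc u ^+ k.
  by elim: k => [|k IHk]; rewrite ?inc1// !expgS incM IHk.
by case: n => n; rewrite /= ?incV incX.
Qed.

Lemma tame_subgroup (G : groupType) (K : subgroup G) :
  labelled K -> tame G -> tame (subgroup_type K).
Proof.
move=> lK [tf vr hG cc]; split.
- move=> u n n0 e; apply: inc_inj; rewrite inc1; apply: (tf _ n) => //.
  by rewrite -expgz_nat -inc_expgz expgz_nat e inc1.
- exact: virtually_retracting_subgroup.
- exact: hcs_subgroup.
- move=> d t dt t1; have [||a [b [a0 e]]] := cc (inc d) (inc t).
  + by rewrite /commute -!incM dt.
  + by move=> e; apply: t1; apply: inc_inj; rewrite e inc1.
  + exists a, b; split=> //; apply: inc_inj.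
    by rewrite inc_expgz -e -expgz_nat inc_expgz.
Qed.

(** * Maps that are conjugations in every finite quotient *)


Lemma hom_on_expgz (G G' : groupType) (L : set G) (f : G -> G') x n :
  is_subgroup L -> hom_on L f -> L x -> f (expgz x n) = expgz (f x) n.
Proof.
move=> sL fM Lx; have fX k : f (x ^+ k) = f x ^+ k.
  elim: k => [|k IHk]; first by rewrite !expg0; apply: hom_on1 fM.
  by rewrite !expgS fM ?IHk//; apply: subgroupX.
case: n => n /=; rewrite ?fX// (hom_onV sL fM) ?fX//.
exact: subgroupX.
Qed.

Lemma labelled_expg (G : groupType) (L : set G) x :
  labelled L -> exists2 m, (0 < m)%N & L (x ^+ m).
Proof.
move=> [T [p pP]]; pose q (i : 'I_#|T|.+1) := p (x ^+ i).
have /injectivePn[i [j nij eij]] : ~~ injectiveb q.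
  apply/negP => /injectiveP/leq_card; rewrite card_ord; lia.
wlog ltij : i j nij eij / (i < j)%N.
  move=> W; have [|lji|/val_inj e] := ltngtP i j; first exact: W.
    by apply: (W j i) => //; rewrite eq_sym.
  by rewrite e eqxx in nij.
exists (j - i)%N; first by rewrite subn_gt0.
have := pP _ _ eij; have {1}-> : (j = i + (j - i) :> nat)%N by lia.
by rewrite expgnDr mulKg.
Qed.

(** * Centralizers and conjugators in finite quotients *)

Lemma is_subgroup_commute (G : groupType) (y : G) :
  is_subgroup [set x | commute x y].
Proof.
split=> /= [|u v uy vy|u uy]; first exact/commute_sym/commute1.
  by apply/commute_sym/commuteM; apply: commute_sym.
by apply/commute_sym/commuteV/commute_sym.
Qed.

Section CofiniteNormal.
Variables (G : groupType) (A : set G).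
Hypothesis cA : cofinite_normal A.
Let sA := cofinite_subgroup cA.

Lemma cofinite_normalC x y : A (x * y) -> A (y * x).
Proof. by move=> /(cofinite_conj cA y^-1); gnorm. Qed.

Lemma conjg_congr x l l' : A (l^-1 * l') -> A ((x ^ l)^-1 * x ^ l').
Proof.
move=> Al; have := subgroupM sA (cofinite_conj cA (x ^ l) (subgroupV sA Al)) Al.
by gnorm.
Qed.

Lemma congr_trans x y z : A (x^-1 * y) -> A (y^-1 * z) -> A (x^-1 * z).
Proof. by move=> Axy Ayz; have := subgroupM sA Axy Ayz; gnorm. Qed.

End CofiniteNormal.

(* In every finite quotient of [G], the map [phi] is on [H] the conjugation by some
   element of [P] that depends on the quotient. *)
Definition profinitely_conjugation (G : groupType) (H : set G) (phi : G -> G)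
    (P : G -> Prop) :=
  forall A, cofinite_normal A ->
  exists2 l, P l & forall x, H x -> A ((phi x)^-1 * x ^ l).

Section Tame.
Variable G : groupType.
Hypothesis tG : tame G.
Implicit Types (x y h t l : G) (H L A B : set G) (f phi : G -> G).

Lemma profinitely_conjugate x y :
  (forall B, cofinite_normal B -> exists m, B (y^-1 * x ^ m)) ->
  exists m, y = x ^ m.
Proof.
move=> xy; have sT := @is_subgroup_setT G.
have [|//|//||m _ ->] := tame_hcs tG sT _ (x := x) (y := y); last by exists m.
  exact: labelled_setT.
by move=> B /xy[m Bm]; exists m.
Qed.

Lemma residually_finite x : (forall B, cofinite_normal B -> B x) -> x = 1.
Proof.
move=> Bx; have [|m] := @profinitely_conjugate x 1.
  by move=> B /Bx ?; exists 1; rewrite invg1 mul1g conjg1.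
by move/eqP; rewrite eq_sym conjg_eq1 => /eqP.
Qed.

Lemma residually_finite_eq x y :
  (forall B, cofinite_normal B -> B (x^-1 * y)) -> x = y.
Proof. by move=> /residually_finite/mulg1_eq; rewrite invgK. Qed.

(* Conjugacy separability of <h>A gives Minasyan's centralizer condition. *)
Lemma centralizer_condition h A : cofinite_normal A ->
  exists2 B, cofinite_normal B & forall l, B (h^-1 * h ^ l) ->
    exists2 c, commute c h & A (c^-1 * l).
Proof.
move=> cA; apply: contrapT => nB; have sA := cofinite_subgroup cA.
(* [P l B] says that [l] violates the condition at [B]. One coset [c * A] contains violations at
   every [B], and [c] itself is congruent modulo [A] to no element centralizing [h]. *)
pose P l B := B (h^-1 * h ^ l) /\ ~ exists2 c, commute c h & A (c^-1 * l).
have [||c [_ nc] cP] := labelled_pigeonhole (cofinite_labelled cA) (P := P).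
- by move=> x B B' BB' [/BB' ? ?].
- move=> B cB; apply: contrapT => nP; apply: nB; exists B => // l Bl.
  by apply: contrapT => nl; apply: nP; exists l.
(* [M] is the product of [<h>] and [A]. Modulo every [B] some element of [A] conjugates [h ^ c] to
   [h], so some [m] in [M] does so exactly. Then [c * m] centralizes [h], and dividing by the power
   of [h] in [m] gives an element congruent to [c]. *)
apply: nc; pose M := [set x | exists n, A ((expgz h n)^-1 * x)].
have AM : A `<=` M by move=> a Aa; exists 0%R; rewrite /= invg1 mul1g.
have sM : is_subgroup M.
  split; first exact/AM/(subgroup1 sA).
    move=> x y [m Ax] [n Ay]; exists (m + n)%R; rewrite expgzD.
    by have := subgroupM sA (cofinite_conj cA (expgz h n) Ax) Ay; gnorm.
  move=> x [n Ax]; exists (- n)%R; rewrite expgzN.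
  by have := subgroupV sA (cofinite_normalC cA Ax); gnorm.
have Mh : M h by exists 1%R; rewrite expgz1 mulVg; apply: subgroup1.
have cJ a : h ^ (c * a) = (h ^ c) ^ a by rewrite conjgM.
have Mhc : M (h ^ c).
  have [l Al [Ahl _]] := cP _ cA.
  have -> : h ^ c = (h ^ l) ^ (c^-1 * l)^-1 by rewrite -conjgM; gnorm.
  apply: (subgroupJ sM); last exact/(subgroupV sM)/AM.
  by exists 1%R; rewrite expgz1.
have [|m [n Am] e] := tame_hcs tG sM (labelled_sub AM (cofinite_labelled cA)) Mhc Mh.
  move=> B /cP[l Al [Bl _]]; exists (c^-1 * l); first exact: AM.
  by rewrite -conjgM mulVKg.
exists (c * m * (expgz h n)^-1).
  apply/commute_sym/commuteM; last exact/commuteV/commute_expgz.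
  by apply/esym; rewrite /commute [RHS]conjgC conjgM -e.
by have := subgroupV sA (cofinite_normalC cA Am); gnorm.
Qed.

Lemma cyclic_retraction h :
  exists L f, virtual_retraction [set expgz h n | n in setT] L f.
Proof.
rewrite -generated1; apply: (tame_vr tG); first exact: is_subgroup_generated.
by exists [:: h].
Qed.

Section CyclicRetraction.
Variables (h : G) (L : set G) (f : G -> G).
Hypothesis fL : virtual_retraction [set expgz h n | n in setT] L f.
Let sL := vr_subgroup fL.
Let fM := vr_hom fL.

Lemma retraction_generator n : L (expgz h n) /\ f (expgz h n) = expgz h n.
Proof. by split; [apply: (vr_sub fL)|apply: (vr_id fL)]; exists n. Qed.

(** Some positive power of [d] is a power of [t] and hence killed by [f]; torsion-freeness does the
    rest. *)
Lemma retraction_commute t d :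
  L t -> f t = 1 -> t <> 1 -> commute d t -> L d -> f d = 1.
Proof.
move=> Lt ft t1 dt Ld; have [a [b [a0 e]]] := tame_cc tG dt t1.
apply: (tame_torsion_free tG a0).
rewrite -expgz_nat -(hom_on_expgz _ sL fM)// expgz_nat e.
rewrite (hom_on_expgz _ sL fM)// ft.
by case: b {e} => b /=; rewrite ?expg1n ?invg1.
Qed.

(** If [f c] is [expgz h n], then [expgz h (- n) * c] commutes with [h] and is killed by [f]. Were
    it nontrivial, [f h = 1] would follow, while [f h = h]. *)
Lemma retraction_centralizer c :
  h <> 1 -> commute c h -> L c -> exists n, c = expgz h n.
Proof.
move=> h1 ch Lc; have [n _ e] := vr_in fL Lc; exists n.
have [Lh fh] := retraction_generator (- n)%R.
apply: contrapT => nc; apply: h1.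
have [L1 f1] := retraction_generator 1%R; rewrite expgz1 in L1 f1.
rewrite -f1; apply: (retraction_commute (t := expgz h (- n)%R * c)) => //.
- exact: subgroupM.
- by rewrite fM// fh -e expgzN mulVg.
- by rewrite expgzN => /mulg1_eq; rewrite invgK => /esym.
- by apply: commuteM; [apply: commute_expgz|apply: commute_sym].
Qed.

End CyclicRetraction.

Section ProfiniteConjugation.
Variables (H : set G) (h : G).
Hypotheses (Hh : H h) (h1 : h <> 1).

Lemma profinitely_conjugation_point phi t :
  profinitely_conjugation H phi (fun=> True) -> H t -> exists g, phi t = t ^ g.
Proof.
move=> Hphi Ht; apply: profinitely_conjugate => B /Hphi[l _ /(_ t Ht) Bl].
by exists l.
Qed.

Lemma profinitely_conjugation_centralizer phi :
  profinitely_conjugation H phi (fun=> True) -> phi h = h ->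
  profinitely_conjugation H phi (commute^~ h).
Proof.
move=> Hphi phih A cA; have [B cB BP] := centralizer_condition h cA.
have [l _ lP] := Hphi _ (cofinite_normalI cA cB).
have [|c ch Ac] := BP l; first by have [_] := lP _ Hh; rewrite phih.
exists c => // x /lP[Al _]; apply: (congr_trans cA Al).
apply: (conjg_congr cA); have := subgroupV (cofinite_subgroup cA) Ac.
by gnorm.
Qed.

(** The conjugators can be taken in one coset [c * L] with [c] centralizing [h]. They differ from
    [c] by elements of [L] that centralize [h], that is, by powers of [h]; the common factor [c] is
    moved to the side of [phi]. *)
Lemma profinitely_conjugation_power phi :
  profinitely_conjugation H phi (commute^~ h) ->
  exists c, profinitely_conjugation H (fun x => phi x ^ c) (range (expgz h)).
Proof.
move=> Hphi; have [L [f fL]] := cyclic_retraction h.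
pose P l A := commute l h /\ forall x, H x -> A ((phi x)^-1 * x ^ l).
have [||c [ch _] cP] := labelled_pigeonhole (vr_labelled fL) (P := P).
- by move=> l A B BA [lh lP]; split=> // x /lP/BA.
- by move=> A /Hphi[l lh lP]; exists l.
exists c^-1 => A cA; have [l Ll [lh lP]] := cP _ cA.
have ch' : commute (c^-1 * l) h.
  by apply/commute_sym/commuteM; [apply/commuteV|]; apply/commute_sym.
have [n e] := retraction_centralizer fL h1 ch' Ll.
exists (expgz h n) => [|x /lP/(cofinite_conj cA c^-1)]; first by exists n.
have -> : l = expgz h n * c by rewrite -(commute_expgz n ch) -e mulVKg.
by gnorm.
Qed.

End ProfiniteConjugation.

(* The finite generation of [H] makes some power of [h] central in [H]. *)
Lemma power_conjugation_elementary H h L f phi :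
  h <> 1 -> is_subgroup H -> finitely_generated H -> H h ->
  virtual_retraction [set expgz h n | n in setT] L f ->
  (forall t, H t -> L t -> f t = 1 -> t = 1) ->
  profinitely_conjugation H phi (range (expgz h)) ->
  exists g, forall x, H x -> phi x = x ^ g.
Proof.
move=> h1 sH [s Hs] Hh fL kerf Hphi.
have sL := vr_subgroup fL; have fM := vr_hom fL.
(* For [x <> 1] some [x ^+ m] lies in [L] and is mapped by [f] to some [expgz h j]. Their quotient
   is killed by [f], so the two are equal by [kerf]. Hence [x] commutes with [expgz h j], and
   [j <> 0] by torsion-freeness. *)
have pow x : H x -> exists2 n, (0 < n)%N & commute x (h ^+ n).
  move=> Hx; have [->|/eqP x1] := eqVneq x 1.
    by exists 1%N => //; apply/commute_sym/commute1.
  have [m m0 Lxm] := labelled_expg x (vr_labelled fL).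
  have [j _ ej] := vr_in fL Lxm.
  have [Lj fj] := retraction_generator fL (- j)%R.
  have xm : x ^+ m = expgz h j.
    have := kerf (x ^+ m * expgz h (- j)%R); rewrite fM// fj -ej expgzN mulgV.
    move=> /(_ _ _ erefl)/divg1_eq; apply.
      exact: (subgroupM sH (subgroupX sH _ Hx) (subgroupV sH (sub_expgz _ sH Hh))).
    by apply: (subgroupM sL); rewrite // -expgzN.
  have xhj : commute x (expgz h j) by rewrite -xm; apply/commuteX.
  exists `|j|%N; last first.
    by case: j {ej Lj fj xm} xhj => j //= /commuteV; rewrite invgK.
  rewrite absz_gt0; apply/eqP => j0; apply: x1.
  by apply: (tame_torsion_free tG m0); rewrite xm j0.
have [n n0 nP] : exists2 n, (0 < n)%N & forall x, H x -> commute x (h ^+ n).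
  have [n n0 nP] : exists2 n, (0 < n)%N & forall x, x \in s -> commute x (h ^+ n).
    have : {subset s <= [pred x | `[< H x >] ]}.
      by move=> x xs; apply/asboolP; rewrite Hs; apply: sub_generated.
    elim: {Hs} s => [|x s IHs] sH'; first by exists 1%N.
    have [|n n0 nP] := IHs; first by move=> y ys; apply: sH'; rewrite inE ys orbT.
    have /asboolP/pow[m m0 mP] : x \in [pred x | `[< H x >] ].
      by apply: sH'; rewrite inE eqxx.
    exists (m * n)%N; first by rewrite muln_gt0 m0.
    move=> y; rewrite inE => /orP[/eqP ->|/nP yn].
      by rewrite expgnA; apply: commuteX.
    by rewrite mulnC expgnA; apply: commuteX.
  exists n => // x; rewrite Hs.
  by apply: (generated_sub (is_subgroup_commute _)) => y /= /nP.
(* As [h ^+ n] centralizes [H], exponents matter only modulo [n], and one residue serves for all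
   [A]. *)
have [||i iP] := @cofinite_normal_pigeonhole G 'I_n
    (fun i A => forall x, H x -> A ((phi x)^-1 * x ^ (h ^+ i))).
- by move=> i A B BA iP x /iP/BA.
- move=> A /Hphi[_ [j _ <-] jP].
  have jn : (`|(j %% n)%Z|%N < n)%N by lia.
  exists (Ordinal jn) => x Hx; have := jP x Hx; congr (A (_ * _)).
  have {1}-> : j = (n%:Z * (j %/ n)%Z + (`|(j %% n)%Z|%N)%:Z)%R by lia.
  rewrite expgzD conjgM expgzM; congr (_ ^ _); apply/conjg_fixP/commgP.
  exact/commute_expgz/nP.
exists (h ^+ i) => x Hx; apply: residually_finite_eq => B cB.
exact: iP.
Qed.

(** Let [g] conjugate [t] to [phi t] exactly. Modulo each [A], the conjugating power of [h] times
    [g^-1] is congruent to an element centralizing [t]. Within [L] that centralizer is killed by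
    [f], so [f] recovers the power of [h] from [g], up to a fixed coset representative. *)
Lemma power_conjugation_nonelementary H h L f phi t :
  virtual_retraction [set expgz h n | n in setT] L f ->
  H t -> L t -> f t = 1 -> t <> 1 ->
  profinitely_conjugation H phi (range (expgz h)) ->
  exists g, forall x, H x -> phi x = x ^ g.
Proof.
move=> fL Ht Lt ft t1 Hphi.
have sL := vr_subgroup fL; have fM := vr_hom fL.
have [g eg] : exists g, phi t = t ^ g.
  by apply: (profinitely_conjugation_point _ Ht) => A /Hphi[l _ lP]; exists l.
pose P e A := commute e t /\ exists j,
  (forall x, H x -> A ((phi x)^-1 * x ^ (expgz h j))) /\
  A (e * expgz h j * g^-1).
have [||e [et _] eP] := labelled_pigeonhole (vr_labelled fL) (P := P).
- move=> e A B BA [et [j [jP /BA Bj]]]; split=> //; exists j; split=> //.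
  by move=> x /jP/BA.
- move=> A cA; have [B cB BP] := centralizer_condition t cA.
  have [_ [j _ <-] jP] := Hphi _ (cofinite_normalI cA cB).
  have [|d dt Ad] := BP (expgz h j * g^-1).
    have [_] := jP _ Ht; rewrite eg => /(cofinite_conj cB g^-1); gnorm.
    by [].
  exists d^-1; split; first exact/commute_sym/commuteV/commute_sym.
  exists j; split; last by rewrite -mulgA.
  by move=> x /jP[].
have [B cB BL] := labelled_core sL (vr_labelled fL).
(* mod any A, the element e^-1 g is a product v * h^j with v in the kernel of f *)
have key A : cofinite_normal A -> exists v j a,
    [/\ L v, f v = 1, A a, e^-1 * g = v * expgz h j * a &
      forall x, H x -> A ((phi x)^-1 * x ^ (expgz h j))].
  move=> cA; have [d Ld [dt [j [jP Aj]]]] := eP _ cA.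
  exists (e^-1 * d), j, ((d * expgz h j * g^-1)^-1 ^ g); split=> //.
  - apply: (retraction_commute fL Lt ft t1) => //.
    by apply/commute_sym/commuteM; [apply/commuteV|]; apply/commute_sym.
  - exact/(cofinite_conj cA)/(subgroupV (cofinite_subgroup cA)).
  - by gnorm.
have [v [j [a [Lv fv /BL La ega _]]]] := key _ cB.
have hL n := retraction_generator fL n.
have Leg : L (e^-1 * g).
  by rewrite ega; apply: (subgroupM sL) => //; apply: (subgroupM sL) => //; case: (hL j).
have [q _ fq] := vr_in fL Leg.
(* The choice of [q] does not depend on [A]. Applying [f] to the decomposition of [e^-1 * g]
   obtained for [A] gives [expgz h q = expgz h k * f b] with [f b] in [A], so both powers conjugate
   alike modulo [A]. *)
exists (expgz h q) => x Hx; apply: residually_finite_eq => A cA.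
have [A' cA' A'P] := labelled_core
  (is_subgroup_preimage sL fM (cofinite_subgroup cA))
  (labelled_preimage sL fM (vr_labelled fL) (cofinite_labelled cA)).
have [w [k [b [Lw fw [/A'P[Lb Afb] Ab] egb /(_ x Hx)[_ kP]]]]] :=
  key _ (cofinite_normalI cA' cA).
apply: (congr_trans cA kP); apply: (conjg_congr cA).
have [Lk fk] := hL k.
suff -> : expgz h q = expgz h k * f b by rewrite mulKg.
by rewrite fq egb !fM// ?fw ?fk ?mul1g//; apply: subgroupM.
Qed.

End Tame.

(** * Separability of conjugacy of subgroups *)


Section Tame.
Variable G : groupType.
Hypothesis tG : tame G.
Implicit Types (x y h t l : G) (A B L : set G) (f phi : G -> G).

Theorem profinitely_conjugation_inner (H : set G) phi :
  is_subgroup H -> finitely_generated H ->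
  profinitely_conjugation H phi (fun=> True) ->
  exists g, forall x, H x -> phi x = x ^ g.
Proof.
move=> sH fgH Hphi.
have [[h Hh h1]|nH] := pselect (exists2 h, H h & h <> 1); last first.
  have H1 x : H x -> x = 1.
    by move=> Hx; apply: contrapT => x1; apply: nH; exists x.
  exists 1 => x /H1 ->; apply/esym/(residually_finite_eq tG) => B cB.
  have [l _ /(_ 1 (subgroup1 sH))] := Hphi _ cB.
  rewrite !conj1g mulg1 => /(subgroupV (cofinite_subgroup cB)); rewrite invgK.
  by rewrite invg1 mul1g.
(* Composing with a conjugation is harmless. It is done twice: to make the map fix [h], and to turn
   the conjugators into powers of [h]. *)
have conj_phi psi g : (exists g', forall x, H x -> psi x ^ g = x ^ g') ->
    exists g, forall x, H x -> psi x = x ^ g.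
  move=> [g' e]; exists (g' * g^-1) => x /e; rewrite conjgM => <-.
  by rewrite conjgK.
have [g eg] := profinitely_conjugation_point tG Hphi Hh.
apply: (conj_phi _ g^-1).
have Hphi' :
    profinitely_conjugation H (fun x => phi x ^ g^-1) (fun=> True).
  move=> A cA; have [l _ lP] := Hphi _ cA; exists (l * g^-1) => // x /lP.
  by move/(cofinite_conj cA g^-1); gnorm.
have [|c Hc] := profinitely_conjugation_power tG h1
    (profinitely_conjugation_centralizer tG Hh Hphi' _).
  by rewrite eg conjgK.
apply: (conj_phi _ c).
have [L [f fL]] := cyclic_retraction tG h.
have [[t [Ht Lt ft t1]]|nt] := pselect (exists t, [/\ H t, L t, f t = 1 & t <> 1]).
  exact: (power_conjugation_nonelementary tG fL Ht Lt ft t1 Hc).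
apply: (power_conjugation_elementary tG h1 sH fgH Hh fL _ Hc) => t Ht Lt ft.
by apply: contrapT => t1; apply: nt; exists t.
Qed.

Lemma hom_on_conjg (c : G) : hom_on setT (conjg^~ c).
Proof. by move=> x y _ _; apply: conjMg. Qed.

Lemma is_subgroup_conjugate_set (H : set G) c :
  is_subgroup H -> is_subgroup (conjugate_set H c).
Proof.
exact: (is_subgroup_image (@is_subgroup_setT G) (hom_on_conjg c) (@subsetT _ H)).
Qed.

Lemma finitely_generated_conjugate_set (H : set G) c :
  finitely_generated H -> finitely_generated (conjugate_set H c).
Proof. exact: finitely_generated_image (hom_on_conjg c). Qed.

(** Continuity of [f] at [1] for the profinite topology. *)
Lemma retraction_congr_core (H L A : set G) f :
  virtual_retraction H L f -> cofinite_normal A ->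
  exists2 B, cofinite_normal B & forall x, B x -> [/\ L x, A x & A (f x)].
Proof.
move=> [sL lL HL fM fin fid] cA.
have [B cB BP] := labelled_core
  (is_subgroup_preimage sL fM (cofinite_subgroup cA))
  (labelled_preimage sL fM lL (cofinite_labelled cA)).
by exists (A `&` B) => [|x [Ax /BP[]]]; [apply: cofinite_normalI|].
Qed.

Theorem conjugate_into_profinite (H1 H2 : set G) :
    is_subgroup H1 -> finitely_generated H1 ->
    is_subgroup H2 -> finitely_generated H2 ->
    (forall A, cofinite_normal A -> exists g, forall h, H2 h ->
      exists2 h', H1 h' & A (h'^-1 * h ^ g)) ->
  conjugate_into H2 H1.
Proof.
move=> sH1 fgH1 sH2 fgH2 H21; have [L [f fL]] := tame_vr tG sH1 fgH1.
have sL := vr_subgroup fL; have fM := vr_hom fL.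
pose P g A := forall h, H2 h -> exists2 h', H1 h' & A (h'^-1 * h ^ g).
have [||c _ cP] := labelled_pigeonhole (vr_labelled fL) (P := P).
- by move=> g A B BA gP h /gP[h' H1h' /BA Ah']; exists h'.
- exact: H21.
have H2L h : H2 h -> L (h ^ c).
  move=> H2h; have [B cB BL] := labelled_core sL (vr_labelled fL).
  have [g Lg /(_ _ H2h)[h' H1h' /BL Lh']] := cP _ cB.
  have -> : h ^ c = (h' * (h'^-1 * h ^ g)) ^ (c^-1 * g)^-1 by gnorm.
  apply: (subgroupJ sL); last exact: subgroupV.
  by apply: (subgroupM sL) => //; apply: (vr_sub fL).
have [|||g gP] := @profinitely_conjugation_inner (conjugate_set H2 c) f.
- exact: is_subgroup_conjugate_set.
- exact: finitely_generated_conjugate_set.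
- move=> A cA; have [B cB BP] := retraction_congr_core fL cA.
  have [g Lg gP] := cP _ cB; set l := c^-1 * g in Lg.
  (* Modulo [A], both [(h ^ c) ^ l] and its image [f (h ^ c) ^ f l] equal [h'], since [f] fixes [H1]
     and sends [n] into [A]. Undoing the conjugation by [f l] yields this conjugator. *)
  exists (l * (f l)^-1) => // _ [h H2h <-].
  have [h' H1h' /BP[]] := gP _ H2h; set n := h'^-1 * h ^ g => Ln An Afn.
  have e : (h ^ c) ^ l = h' * n by rewrite -conjgM mulVKg /n mulVKg.
  clearbody n l.
  have Lh' := vr_sub fL H1h'.
  have fe : f (h ^ c) ^ f l = h' * f n.
    by rewrite -(hom_onJ sL fM) ?e ?(fM h' n) ?(vr_id fL H1h')//; apply: H2L.
  have -> : (f (h ^ c))^-1 * (h ^ c) ^ (l * (f l)^-1) =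
      ((f (h ^ c) ^ f l)^-1 * (h ^ c) ^ l) ^ (f l)^-1.
    by rewrite [RHS]conjMg conjVg conjgK conjgM.
  apply: (cofinite_conj cA); rewrite e fe invgM -mulgA mulKg.
  apply: (subgroupM (cofinite_subgroup cA)) => //.
  exact: (subgroupV (cofinite_subgroup cA)).
exists (c * g) => _ [h H2h <-]; rewrite conjgM -gP; last by exists h.
exact/(vr_in fL)/H2L.
Qed.

(** [H] is the fixed point set of a continuous [f], hence closed: if [x = h * n] with [n] small,
    then [(f x)^-1 * x = (f n)^-1 * n] is trivial modulo [A]. *)
Lemma finitely_generated_separable (H : set G) x :
    is_subgroup H -> finitely_generated H ->
    (forall A, cofinite_normal A -> exists2 h, H h & A (h^-1 * x)) ->
  H x.
Proof.
move=> sH fgH Hx; have [L [f fL]] := tame_vr tG sH fgH.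
have fM := vr_hom fL.
have Lx : L x.
  have [B cB BP] := retraction_congr_core fL (cofinite_normalT G).
  have [h /(vr_sub fL) Lh /BP[Lhx _ _]] := Hx _ cB.
  by rewrite -(mulVKg h x); apply: (subgroupM (vr_subgroup fL)).
suff <- : f x = x by apply: (vr_in fL).
apply: (residually_finite_eq tG) => A cA.
have [B cB BP] := retraction_congr_core fL cA.
have [h Hh /BP[Lhx Ahx Afhx]] := Hx _ cB.
have -> : (f x)^-1 * x = (f (h^-1 * x))^-1 * (h^-1 * x).
  have Lh := vr_sub fL Hh.
  rewrite fM//; last exact: subgroupV (vr_subgroup fL) _ _.
  by rewrite (hom_onV (vr_subgroup fL) fM)// (vr_id fL Hh)//; gnorm.
apply: (subgroupM (cofinite_subgroup cA)) => //.
exact: (subgroupV (cofinite_subgroup cA)).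
Qed.

(** Modulo [A] some power [g ^+ m.+1] is trivial, so [x] in [H] is congruent to its conjugate by
    that power, which lies in [conjugate_set H g]. This conjugate subgroup is separable, so it
    contains [x]. *)
Lemma conjugate_set_sub_eq (H : set G) g :
    is_subgroup H -> finitely_generated H ->
  conjugate_set H g `<=` H -> conjugate_set H g = H.
Proof.
move=> sH fgH gH; apply/seteqP; split=> // x Hx.
apply: finitely_generated_separable.
- exact: is_subgroup_conjugate_set.
- exact: finitely_generated_conjugate_set.
move=> A cA; have [[//|m] _ Agm] := labelled_expg g (cofinite_labelled cA).
exists ((x ^ (g ^+ m)) ^ g); last first.
  rewrite -conjgM -expgSr -{2}(conjg1 x); apply: (conjg_congr cA).
  by rewrite mulg1; apply: (subgroupV (cofinite_subgroup cA)).
exists (x ^ (g ^+ m)) => //; elim: m {Agm} => [|m IHm].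
  by rewrite expg0 conjg1.
by rewrite expgSr conjgM; apply: gH; exists (x ^ (g ^+ m)).
Qed.

Lemma quotient_conjugate (Q : finGroupType) (f : {multiplicative G -> Q})
    (A : set G) (h h' g : G) :
  (forall x, f x = 1 -> A x) -> f h ^ f g = f h' -> A (h'^-1 * h ^ g).
Proof.
move=> fA e; have fM : hom_on setT f by move=> x y _ _; apply: gmulfM.
have sT := @is_subgroup_setT G.
by apply: fA; rewrite gmulfM (hom_onV sT fM)// (hom_onJ sT fM)// e mulVg.
Qed.

Theorem tame_SICS : SICS G.
Proof.
move=> H1 H2 fg1 fg2 nc; apply: contrapT => nQ; apply: nc.
apply: conjugate_into_profinite => //; [exact: subgroupP|exact: subgroupP|].
move=> A cA.
have [Q [f [surjf fA]]] := finite_quotient (cofinite_subgroup cA) (cofinite_labelled cA).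
have [c cP] : conjugate_into (f @` H2) (f @` H1).
  by apply: contrapT => nc; apply: nQ; exists Q, f.
have [g _ eg] := surjf c I; exists g => h H2h.
have [|h' H1h' e] := cP (f h ^ c); first by exists (f h) => //; exists h.
by exists h' => //; apply: (quotient_conjugate fA); rewrite e eg.
Qed.

Theorem tame_SCS : SCS G.
Proof.
move=> H1 H2 fg1 fg2 nc; apply: contrapT => nQ; apply: nc.
have s1 := subgroupP H1; have s2 := subgroupP H2.
have H12 A : cofinite_normal A ->
    exists (Q : finGroupType) (f : {multiplicative G -> Q}) (g : G),
    (forall x, f x = 1 -> A x) /\ conjugate_set (f @` H1) (f g) = f @` H2.
  move=> cA.
  have [Q [f [surjf fA]]] :=
    finite_quotient (cofinite_subgroup cA) (cofinite_labelled cA).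
  have [c cP] : conjugate_subgroups (f @` H1) (f @` H2).
    by apply: contrapT => nc; apply: nQ; exists Q, f.
  by have [g _ eg] := surjf c I; exists Q, f, g; rewrite eg.
have [a aP] : conjugate_into H1 H2.
  apply: conjugate_into_profinite => // A /H12[Q [f [g [fA gP]]]].
  exists g => h H1h.
  have [h' H2h' e] : (f @` H2) (f h ^ f g).
    by rewrite -gP; exists (f h) => //; exists h.
  by exists h' => //; apply: (quotient_conjugate fA); rewrite e.
have [b bP] : conjugate_into H2 H1.
  apply: conjugate_into_profinite => // A /H12[Q [f [g [fA gP]]]].
  exists g^-1 => h H2h.
  have [_ [h' H1h' <-] e] : conjugate_set (f @` H1) (f g) (f h).
    by rewrite gP; exists h.
  exists h' => //; apply: (quotient_conjugate fA); rewrite -e.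
  have fM : hom_on setT f by move=> x y _ _; apply: gmulfM.
  by rewrite (hom_onV (@is_subgroup_setT G) fM)// conjgK.
exists a; apply/seteqP; split=> // x H2x.
(* Conjugation by [b] and then by [a] maps [H2] into [H1] and back into [H2], hence onto [H2]; so
   the conjugate of [H1] by [a] is all of [H2]. *)
have e : conjugate_set H2 (b * a) = H2.
  apply: conjugate_set_sub_eq => // _ [y H2y <-]; rewrite conjgM.
  by apply: aP; exists (y ^ b) => //; apply: bP; exists y.
move: H2x; rewrite -{1}e => -[y H2y <-]; exists (y ^ b); last by rewrite conjgM.
by apply: bP; exists y.
Qed.

End Tame.

(** * Excluding Z x Z *)


Section WordLength.
Variables (G : groupType) (s : seq G).
Hypothesis sG : subgroup_generated [set` s] = [set: G].
Implicit Types (g h x y u : G).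

Let generator a := (a \in s) || (a^-1 \in s).

Lemma spelledM g h m n : spelled s g m -> spelled s h n -> spelled s (g * h) (m + n).
Proof.
move=> [v [<- vs ->]] [w [<- ws ->]]; exists (v ++ w).
by rewrite size_cat all_cat vs ws big_cat.
Qed.

Lemma spelledV g n : spelled s g n -> spelled s g^-1 n.
Proof.
move=> [w [<- ws ->]]; exists (rev (map inv w)); split.
- by rewrite size_rev size_map.
- rewrite all_rev all_map; apply: sub_all ws => a /=.
  by rewrite invgK orbC.
- by rewrite -map_rev big_map prodgV revK.
Qed.

Lemma spelled_ex g : exists n, spelled s g n.
Proof.
suff sub : subgroup_generated [set` s] `<=` [set x | exists n, spelled s x n].
  by apply: sub; rewrite sG.
apply: generated_sub.
  split=> [|x y [m xm] [n yn]|x [n xn]].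
  - by exists 0%N, [::]; rewrite big_nil.
  - by exists (m + n)%N; apply: spelledM.
  - by exists n; apply: spelledV.
by move=> a /= sa; exists 1%N, [:: a]; rewrite big_seq1 /= sa.
Qed.

Lemma word_length_spelled g : spelled s g (word_length s g).
Proof.
rewrite /word_length; case: pselect => [e|[]].
  by case: ex_minnP => n /asboolP.
by have [n gn] := spelled_ex g; exists n; apply/asboolP.
Qed.

Lemma word_length_min g n : spelled s g n -> (word_length s g <= n)%N.
Proof.
move=> gn; rewrite /word_length; case: pselect => [e|[]].
  by case: ex_minnP => m _; apply; apply/asboolP.
by exists n; apply/asboolP.
Qed.

Lemma word_lengthV g : word_length s g^-1 = word_length s g.
Proof.
have le h : (word_length s h^-1 <= word_length s h)%N.
  exact/word_length_min/spelledV/word_length_spelled.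
by apply/eqP; rewrite eqn_leq le -{1}(invgK g) le.
Qed.

(* Reidemeister-Schreier: (r (p (a * g)))^-1 * a * r (p g), for a generator [a],
   takes finitely many values in [L]. *)
Lemma character_lipschitz (L : set G) (chi : G -> int) :
    is_subgroup L -> labelled L ->
    (forall x y, L x -> L y -> chi (x * y) = (chi x + chi y)%R) ->
  exists C : nat, forall x, L x -> (absz (chi x) <= C * (word_length s x).+1)%N.
Proof.
move=> sL [T [p pP]] chiM; have [r rP] := label_representative p.
have rL g : L ((r (p g))^-1 * g) by apply: pP; rewrite rP.
pose b a (t u : T) := absz (chi ((r u)^-1 * a * r t)).
pose S := s ++ map inv s.
pose C0 := (\sum_(a <- S) \sum_t \sum_u b a t u)%N.
have bC0 a (t u : T) : generator a -> (b a t u <= C0)%N.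
  move=> ga; have aS : a \in S.
    rewrite mem_cat; case/orP: ga => [->//|sa]; apply/orP; right.
    by apply/mapP; exists a^-1; rewrite ?invgK.
  rewrite /C0 (big_rem a aS)/= (bigD1 t)//= (bigD1 u)//=; lia.
pose C1 := (\sum_t absz (chi (r t)))%N.
have C1P t : (absz (chi (r t)) <= C1)%N by rewrite /C1 (bigD1 t)//=; lia.
pose C2 := absz (chi ((r (p 1))^-1 * 1)).
exists (C0 + C1 + C2)%N => x Lx.
(* Prefixing a letter multiplies the offset of [g] from its representative by one Schreier element,
   on which [chi] is at most [C0] in absolute value; [C2] accounts for the empty word. *)
have kappa w : all generator w -> let g := \prod_(a <- w) a in
    (absz (chi ((r (p g))^-1 * g)%g) <= C0 * size w + C2)%N.
  elim: w => [|a w IHw] /=; first by rewrite big_nil muln0.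
  rewrite big_cons => /andP[ga /IHw]; set g := \prod_(i <- w) i => IH.
  have Lb : L ((r (p (a * g)))^-1 * a * r (p g)).
    have := subgroupM sL (rL (a * g)) (subgroupV sL (rL g)); gnorm.
    by [].
  have -> : (r (p (a * g)))^-1 * (a * g) =
      ((r (p (a * g)))^-1 * a * r (p g)) * ((r (p g))^-1 * g) by gnorm.
  rewrite chiM//; have := bC0 a (p g) (p (a * g)) ga; move: IH; rewrite /b mulnS /=; lia.
have [w [sw gw ew]] := word_length_spelled x.
have := kappa w gw; rewrite /= -ew sw => kx.
have Lr : L (r (p x)).
  by have := subgroupM sL Lx (subgroupV sL (rL x)); gnorm.
have := chiM _ _ Lr (rL x); rewrite mulVKg => ->.
have := C1P (p x); move: kx; set m := word_length s x.
by nia.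
Qed.

End WordLength.

(** * Gromov products along paths *)

Local Open Scope ring_scope.
Import Order.TTheory GRing.Theory Num.Theory.

(** The sequence [u k / 2 ^+ k] would drop by at least [e] at each step, up to summable errors, and
    so become negative. *)
Lemma no_linear_halving_defect (u : nat -> rat) (e b d : rat) :
    0 < e -> 0 <= b -> 0 <= d -> (forall k, 0 <= u k) ->
  ~ forall k, e * 2 ^+ k - b - d * k%:R <= u k - u k.+1 / 2.
Proof.
move=> e0 b0 d0 u0 ub.
(* adding an affine function of k to u removes the error terms *)
pose w k := u k + 2 * d * k%:R + 2 * (b + d).
have wS k : w k.+1 <= 2 * w k - 2 * e * 2 ^+ k.
  by have := ub k; rewrite /w -[k.+1%:R]natr1; lra.
have wb k : w k <= 2 ^+ k * (w 0%N - k%:R * e).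
  elim: k => [|k IHk]; first by rewrite expr0 mul0r subr0 mul1r.
  by apply: le_trans (wS k) _; rewrite exprS -[k.+1%:R]natr1; lra.
have w0 k : 0 <= w k.
  by rewrite /w; have := u0 k; have : 0 <= d * k%:R by [rewrite mulr_ge0]; lra.
pose k := Num.truncn (w 0%N / e); have := wb k.+1.
have : w 0%N / e < k.+1%:R by apply: truncnS_gt.
rewrite ltr_pdivrMr// => ke wk.
have := le_trans (w0 k.+1) wk.
have p2 : (0 : rat) < 2 ^+ k.+1 by apply: exprn_gt0.
by rewrite (pmulr_rge0 _ p2) subr_ge0 leNgt ke.
Qed.

(** The four-point inequality is used twice on a path with three sides, whose Gromov products are
    [p1], [p2] and [p4]; [p3] belongs to the ends of the first two sides. The middle side is twice
    as long as the others, which costs one more [de]. *)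
Lemma gromov_chain (e de a b c u v p1 p2 p3 p4 : rat) :
    0 <= a -> 0 <= b -> 0 <= de ->
    e - 1 - b / 2 - c <= p1 -> e - 1 - a / 2 - (c + de) <= p2 ->
    e - 1 - b / 2 - c <= p4 -> Num.min p1 p2 - de <= p3 ->
    Num.min p3 p4 - de <= (u + u - v) / 2 ->
  e - (1 + a + b + 3 * de) - c <= u - v / 2.
Proof.
move=> a0 b0 de0 p1E p2E p4E p3E uvE.
have p3E' : e - 1 - a - b - c - 2 * de <= p3.
  apply: le_trans p3E; rewrite -lerBDr opprK le_min.
  by apply/andP; split; lra.
have : e - 1 - a - b - c - 3 * de <= (u + u - v) / 2.
  apply: le_trans uvE; rewrite -lerBDr opprK le_min.
  by apply/andP; split; lra.
lra.
Qed.

Section Hyperbolic.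
Variables (G : groupType) (s : seq G) (delta : rat).
Hypothesis sG : subgroup_generated [set` s] = [set: G].
Hypothesis delta0 : 0 <= delta.

Local Notation len g := ((word_length s g)%:R : rat).

Let gp (x y : G) : rat := (len x + len y - len (x^-1 * y)%g) / 2.

Hypothesis hyp : forall x y z, Num.min (gp x z) (gp z y) - delta <= gp x y.

(** Bisection: both halves satisfy the bound for [k], and joining them at the midpoint costs one
    more [delta]. *)
Lemma gromov_product_segment k (x u : G) (E : rat) :
    (forall i, (i <= 2 ^ k)%N -> E <= len (x * u ^+ i)%g) ->
  E - len u / 2 - delta * k%:R <= gp x (x * u ^+ (2 ^ k))%g.
Proof.
elim: k x => [|k IHk] x xE.
  have := xE 0%N isT; have := xE 1%N isT.
  rewrite /gp expn0 expg0 expg1 mulg1 mulKg; lra.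
have e : (x * u ^+ (2 ^ k.+1) = x * u ^+ (2 ^ k) * u ^+ (2 ^ k))%g.
  by rewrite -mulgA -expgnDr addnn -mul2n -expnS.
have k2 : (2 ^ k.+1 = 2 ^ k + 2 ^ k)%N by rewrite expnS mul2n addnn.
have h1 := IHk x (fun i ik => xE i (leq_trans ik _)).
have {}h1 : E - len u / 2 - delta * k%:R <= gp x (x * u ^+ (2 ^ k))%g.
  by apply: h1; rewrite k2 leq_addr.
have {IHk} h2 : E - len u / 2 - delta * k%:R <=
    gp (x * u ^+ (2 ^ k))%g (x * u ^+ (2 ^ k.+1))%g.
  rewrite e; apply: IHk => i ik; rewrite -mulgA -expgnDr; apply: xE.
  by rewrite k2 leq_add2l.
have : E - len u / 2 - delta * k%:R <=
    Num.min (gp x (x * u ^+ (2 ^ k))%g) (gp (x * u ^+ (2 ^ k))%g (x * u ^+ (2 ^ k.+1))%g).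
  by rewrite le_min h1.
have := hyp x (x * u ^+ (2 ^ k.+1))%g (x * u ^+ (2 ^ k))%g.
by rewrite -[k.+1%:R]natr1; lra.
Qed.

(* The path d^n, d^n t^n, d^-n t^n, d^-n stays far from 1, which bounds the Gromov
   product of d^n and d^-n from below. *)
Lemma commuting_halving_defect (d t : G) (C k : nat) : commute d t ->
    (forall i j : int, (absz i <= C * (word_length s (expgz d i * expgz t j)%g).+1)%N /\
       (absz j <= C * (word_length s (expgz d i * expgz t j)%g).+1)%N) ->
  (C.+1%:R)^-1 * 2 ^+ k - (1 + len d + len t + 3 * delta) - delta * k%:R <=
    len (d ^+ (2 ^ k))%g - len (d ^+ (2 ^ k.+1))%g / 2.
Proof.
(* [E] is the lower bound on lengths that [far] gives for an exponent of size at least [n]; [C.+1]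
   replaces [C] to keep the divisor positive. *)
move=> dt far; pose n := (2 ^ k)%N; pose E : rat := n%:R / C.+1%:R - 1.
have ct i j : commute (expgz d i) (expgz t j).
  exact/commute_expgz/commute_sym/commute_expgz/commute_sym.
have C0 : (0 : rat) < C.+1%:R by rewrite ltr0n.
have bound (i j : int) : (n <= absz i)%N \/ (n <= absz j)%N ->
    E <= len (expgz d i * expgz t j)%g.
  move=> nij; have [fi fj] := far i j.
  rewrite /E lerBlDr ler_pdivrMr// natr1 -natrM ler_nat.
  have /leq_trans : (n <= C * (word_length s (expgz d i * expgz t j)%g).+1)%N.
    by case: nij => /leq_trans; apply.
  by apply; rewrite mulnC leq_mul2l leqnSn orbT.
have lenV g : len (g^-1)%g = len g by rewrite word_lengthV.
have seg1 : E - len t / 2 - delta * k%:R <= gp (expgz d n) (expgz d n * expgz t n)%g.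
  by apply: gromov_product_segment => i _; apply: (bound n i); left.
(* The middle side takes [2 ^ k.+1] steps [d^-1], one power of two more than the other sides; along
   it the exponent of [t] stays equal to [n] and keeps the path far from [1]. *)
have seg2 : E - len d / 2 - delta * k.+1%:R <=
    gp (expgz d n * expgz t n)%g (expgz d (- n%:Z) * expgz t n)%g.
  have -> : (expgz d (- n%:Z) * expgz t n = expgz d n * expgz t n * d^-1 ^+ (2 ^ k.+1))%g.
    rewrite expVgn -(expgz_nat d (2 ^ k.+1)) -expgzN -mulgA -(ct _ n) mulgA -expgzD.
    by congr (expgz d _ * _)%g; rewrite expnS /n; lia.
  rewrite -(lenV d); apply: gromov_product_segment => i _.
  rewrite expVgn -(expgz_nat d i) -expgzN -mulgA -(ct _ n) mulgA -expgzD.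
  by apply: bound; right.
have seg3 : E - len t / 2 - delta * k%:R <=
    gp (expgz d (- n%:Z) * expgz t n)%g (expgz d (- n%:Z)).
  have {2}-> : (expgz d (- n%:Z) = expgz d (- n%:Z) * expgz t n * t^-1 ^+ (2 ^ k))%g.
    by rewrite expVgn mulgK.
  rewrite -(lenV t); apply: gromov_product_segment => i _.
  rewrite expVgn -(expgz_nat t i) -expgzN -mulgA -expgzD.
  by apply: bound; left; lia.
have lenP g : 0 <= len g by apply: ler0n.
have dk : delta * k.+1%:R = delta * k%:R + delta :> rat.
  by rewrite -[k.+1%:R]natr1 mulrDr mulr1.
have dn : (expgz d (- n%:Z) = (d ^+ n)^-1)%g by rewrite expgzN.
have d2n : ((d ^+ n)^-1 * (d ^+ n)^-1 = (d ^+ (2 ^ k.+1))^-1)%g.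
  by rewrite -invgM -expgnDr addnn -mul2n -expnS.
have := hyp (expgz d n) (expgz d (- n%:Z)) (expgz d (- n%:Z) * expgz t n)%g.
have := hyp (expgz d n) (expgz d (- n%:Z) * expgz t n)%g (expgz d n * expgz t n)%g.
move: seg1 seg2 seg3; rewrite dk.
move: (gp (expgz d n) (expgz d n * _)%g) (gp (expgz d n * _)%g _) => p1 p2.
move: (gp (expgz d n) (_ * _)%g) (gp (_ * _)%g _) => p3 p4.
rewrite /gp dn expgz_nat d2n !lenV /E natrX [_^-1 * _]mulrC.
move: (lenP d) (lenP t) delta0.
move: (len d) (len t) (delta * k%:R) (len (d ^+ n)%g) (len (d ^+ (2 ^ k.+1))%g).
move: (2 ^+ k / C.+1%:R) delta => e de a b c u v a0 b0 de0 p1E p2E p4E p3E uvE.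
exact: gromov_chain p1E p2E p4E p3E uvE.
Qed.

End Hyperbolic.

(** If [d] and [t] are not commensurable, the exponents of an element of [<d, t>] are unique.
    Composed with the retraction they are homomorphisms from [L] to the integers, hence bounded
    linearly in the word length, as [commuting_halving_defect] requires. *)
Lemma hyperbolic_commuting_commensurable (G : groupType) :
  torsion_free G -> hyperbolic G -> virtually_retracting G ->
  commuting_commensurable G.
Proof.
move=> tfG [s [sG [delta delta0 hyp]]] vrG d t dt t1; apply: contrapT => ndt.
have [||L [f fL]] := vrG (subgroup_generated [set` [:: d; t]]).
- exact: is_subgroup_generated.
- by exists [:: d; t].
have sL := vr_subgroup fL; have fM := vr_hom fL.
have ct i j : commute (expgz d i) (expgz t j).
  exact/commute_expgz/commute_sym/commute_expgz/commute_sym.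
have inH i j : subgroup_generated [set` [:: d; t]] (expgz d i * expgz t j)%g.
  by rewrite generated2//; exists i, j.
(* A nonzero [i] of either sign would make a positive power of [d] a power of [t]; once [i = 0],
   torsion-freeness gives [j = 0]. *)
have zero i j : (expgz d i * expgz t j = 1)%g -> i = 0 /\ j = 0.
  move=> e; have i0 : i = 0.
    apply: contrapT => /eqP i0; apply: ndt.
    have e' : expgz d i = expgz t (- j) by rewrite expgzN; apply/divg1_eq; rewrite invgK.
    case: i e e' i0 => i e e' i0.
      by exists i, (- j); split; [lia|].
    exists i.+1, j; split=> //.
    by move: e' => /= /(congr1 inv); rewrite invgK expgzN invgK.
  split=> //; move: e; rewrite i0 mul1g => /(expgz_eq1 tfG)[|//].
  by move/t1.
(* [chi x] is the pair of exponents of [f x], with default [(0, 0)] outside [L]. *)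
have /boolp.choice[chi chiP] : forall x, exists ij : int * int,
    L x -> f x = (expgz d ij.1 * expgz t ij.2)%g.
  move=> x; have [Lx|nLx] := pselect (L x); last by exists (0, 0).
  have := vr_in fL Lx; rewrite generated2// => -[i [j e]].
  by exists (i, j).
have uniq i j i' j' : (expgz d i * expgz t j = expgz d i' * expgz t j')%g ->
    i = i' /\ j = j'.
  move=> e; suff [] : i - i' = 0 /\ j - j' = 0 by lia.
  apply: zero; rewrite addrC !expgzD !expgzN -mulgA.
  by rewrite [X in (_ * X)%g]mulgA e -!mulgA mulKg mulgV.
have chiM x y : L x -> L y ->
    (chi (x * y)%g).1 = (chi x).1 + (chi y).1 /\
    (chi (x * y)%g).2 = (chi x).2 + (chi y).2.
  move=> Lx Ly; apply: uniq; rewrite -chiP ?fM ?chiP//; last exact: subgroupM.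
  rewrite !expgzD !mulgA; congr (_ * _)%g.
  by rewrite -!mulgA; congr (_ * _)%g; rewrite ct.
have chi_dt i j : chi (expgz d i * expgz t j)%g = (i, j).
  have Ldt : L (expgz d i * expgz t j)%g by apply: (vr_sub fL).
  have := chiP _ Ldt; rewrite (vr_id fL)// => /uniq[].
  by case: (chi _) => /= a b <- <-.
have [C1 C1P] := character_lipschitz sG sL (vr_labelled fL)
  (fun x y Lx Ly => (chiM x y Lx Ly).1).
have [C2 C2P] := character_lipschitz sG sL (vr_labelled fL)
  (fun x y Lx Ly => (chiM x y Lx Ly).2).
apply: (@no_linear_halving_defect (fun k => (word_length s (d ^+ (2 ^ k)))%:R)
  ((C1 + C2).+1%:R)^-1
  (1 + (word_length s d)%:R + (word_length s t)%:R + 3 * delta) delta) => //.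
- by rewrite invr_gt0 ltr0n.
- by rewrite !addr_ge0// mulr_ge0.
move=> k; apply: commuting_halving_defect => //.
  move=> x y z; have := hyp 1%g x y z.
  by rewrite /gromov_product /word_dist !mulg1 !(word_lengthV sG).
move=> i j; have Ldt : L (expgz d i * expgz t j)%g by apply: (vr_sub fL).
have := C1P _ Ldt; have := C2P _ Ldt; rewrite !chi_dt /=.
set m := word_length _ _; nia.
Qed.

Theorem corollaryB (G : groupType) :
  torsion_free G -> hyperbolic G -> property_LR G ->
  hereditarily conjugacy_separable G ->
  hereditarily SICS G /\ hereditarily SCS G.
Proof.
move=> tfG hG /property_LR_virtually_retracting vrG /hcsP csG.
have tG : tame G.
  by split=> //; apply: hyperbolic_commuting_commensurable.
by split=> K /(finite_index_labelled (subgroupP K)) lK;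
  [apply: tame_SICS|apply: tame_SCS]; apply: tame_subgroup.
Qed.
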